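(* For any utility class $C\in\{\text{sum},\text{min},\text{max}\}$, the $(k,m)$-Middle mechanism is not group-strategyproof when $k\ge 2$.
   Context: Setting: a finite nonempty set $N$ of $n$ agents and $m\ge 2$ facilities $1,\dots,m$, of which exactly $k$ must be chosen and located, $1\le k<m$. Agent $i$ has a position $x_i\in[0,1]$ and an approval preference $t_i\in\{0,1\}^m$ ($t_{ij}=1$ iff $i$ approves facility $j$). An instance is $I=(\mathbf{x},\mathbf{t},m,k)$. An outcome is a pair $(S,\mathbf{y})$, where $S$ is a set of $k$ facilities and $\mathbf{y}=(y_j)_{j\in S}$ with $y_j\in[0,1]$ the location of facility $j$. With $d(x,y)=|x-y|$, the three utility classes are $$u_i^{\text{sum}}(S,\mathbf{y}|I)=\sum_{j\in S}t_{ij}(1-d(x_i,y_j)),\quad u_i^{\text{min}}(S,\mathbf{y}|I)=\max_{j\in S}\{t_{ij}(1-d(x_i,y_j))\},\quad u_i^{\text{max}}(S,\mathbf{y}|I)=\min_{j\in S}\{t_{ij}(1-d(x_i,y_j))\}.$$ For a utility class $C$, all agents have utilities $u_i=u_i^{C}$. A deterministic mechanism maps each reported instance to an outcome. Agents may misreport both positions and preferences. A mechanism is group-strategyproof if no nonempty coalition of agents (of any instance) can jointly misreport so that every member's true utility strictly increases. $(k,m)$-Middle mechanism: count the number $n_j$ of agents that approve each facility $j\in\{1,\dots,m\}$; locate the $k$ facilities with the largest counts at $1/2$, breaking ties arbitrarily.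
   Formalization: For fixed k and m the claim is proved for m ≥ k+2 only, under every tie-breaking; when m = k+1 and ties are broken by a fixed priority order, the Middle mechanism is group-strategyproof, so the claim fails there. *)

(* Defs.v *)
From HB Require Import structures.
From mathcomp Require Import all_boot all_order all_algebra.
From mathcomp Require Import reals.

Set Implicit Arguments.
Unset Strict Implicit.
Unset Printing Implicit Defensive.

Import Order.TTheory GRing.Theory Num.Theory.
Local Open Scope ring_scope.

Record instance (R : realType) (n m k : nat) := Instance {
  pos : {ffun 'I_n -> R};
  approves : {ffun 'I_n -> {ffun 'I_m -> bool}};
  agents_gt0 : (0 < n)%N;
  k_range : (0 < k < m)%N;
  pos_range : [forall i, 0 <= pos i <= 1]
}.

(* Only the values of [loc] on [chosen] are meaningful. *)
Record outcome (R : realType) (m k : nat) := Outcome {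
  chosen : {set 'I_m};
  loc : {ffun 'I_m -> R};
  card_chosen : #|chosen| == k;
  loc_range : [forall j in chosen, 0 <= loc j <= 1]
}.

Inductive utility_class := SumClass | MinClass | MaxClass.

Section Model.

Variable R : realType.

Definition facility_utility n m k (I : instance R n m k) (O : outcome R m k)
    (i : 'I_n) (j : 'I_m) : R :=
  (approves I i j)%:R * (1 - `|pos I i - loc O j|).

(* The class names refer to distances, so MinClass maximises the utility over
   the chosen facilities and MaxClass minimises it. Since [chosen O] is nonempty
   and facility utilities lie in [0, 1], the default values 0 and 1 of the
   iterated max and min do not affect the result. *)
Definition utility (C : utility_class) n m k (I : instance R n m k)
    (O : outcome R m k) (i : 'I_n) : R :=
  match C with
  | SumClass => \sum_(j in chosen O) facility_utility I O i j
  | MinClass => \big[Num.max/0]_(j in chosen O) facility_utility I O i j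
  | MaxClass => \big[Num.min/1]_(j in chosen O) facility_utility I O i j
  end.

Definition mechanism := forall n m k : nat, instance R n m k -> outcome R m k.

(* [I] is the true instance and [I'] the reported one. *)
Definition profitable_misreport (C : utility_class) (M : mechanism) n m k
    (I I' : instance R n m k) (G : {set 'I_n}) : Prop :=
  [/\ G != set0,
      forall i, i \notin G -> pos I' i = pos I i /\ approves I' i = approves I i
    & forall i, i \in G -> utility C I (M n m k I) i < utility C I (M n m k I') i].

(* Group-strategyproofness on the instances with [m] facilities of which [k]
   are chosen, for any number of agents. *)
Definition group_strategyproof (C : utility_class) (M : mechanism) (k m : nat)
    : Prop :=
  forall n (I I' : instance R n m k) (G : {set 'I_n}),
    ~ profitable_misreport C M I I' G.

Definition approval_count n m k (I : instance R n m k) (j : 'I_m) : nat :=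
  #|[set i | approves I i j]|.

(* Ties between approval counts are unconstrained: they may be broken
   differently on different instances. *)
Definition is_middle (M : mechanism) : Prop :=
  forall n m k (I : instance R n m k),
    (forall j l, j \in chosen (M n m k I) -> l \notin chosen (M n m k I) ->
       (approval_count I l <= approval_count I j)%N) /\
    (forall j, j \in chosen (M n m k I) -> loc (M n m k I) j = 1 / 2).

End Model.

(* Main.v *)
Require Import Defs.
From HB Require Import structures.
From mathcomp Require Import all_boot all_order all_algebra.
From mathcomp Require Import reals.
From mathcomp Require Import lra zify.

Set Implicit Arguments.
Unset Strict Implicit.
Unset Printing Implicit Defensive.

Import Order.TTheory GRing.Theory Num.Theory.
Local Open Scope ring_scope.

(** Seven agents, all at [1/2], suffice; write [F] for the first [k] facilities
and [a], [b] for the next two. The coalition consists of agents 0, 1 (type A)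
and 2, 3 (type B), and the truthful counts are strictly separated, so that
tie-breaking plays no role.
- Sum and min: type A approves only [a], type B only [b], and the other three
  agents approve [F]. The counts 3 on [F] against 2 on [a] and [b] give the
  coalition utility 0; if all its members report [{a, b}], these two facilities
  get 4 votes and are both chosen.
- Max: type A approves [F] and [a], type B approves [F] and [b], and the other
  three agents approve [{a, b}]. The counts 5 on [a] and [b] against 4 on [F]
  make both [a] and [b] chosen, and so give the coalition utility 0; if its
  members report only [F], then [a] and [b] drop to 3 and exactly [F] is
  chosen. *)

Section Middle.

Variables (R : realType) (M : mechanism R).
Hypothesis hM : is_middle M.

(** If some [j] in [S] were left out, every chosen [l] would lie in [S], since a chosen [l] outside
    [S] would have fewer approvals than the unchosen [j]. All [k] choices would then fit in
    [S :\ j], which has fewer than [k] elements. *)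
Lemma middle_top_chosen n m k (I : instance R n m k) (S : {set 'I_m}) :
  (#|S| <= k)%N ->
  (forall j l, j \in S -> l \notin S ->
     (approval_count I l < approval_count I j)%N) ->
  S \subset chosen (M I).
Proof.
move=> cardS topS; apply/subsetP => j jS; apply/negPn/negP => jM.
have sub : chosen (M I) \subset S :\ j.
  apply/subsetP => l lM; rewrite !inE; apply/andP; split.
    by apply: contraNneq jM => <-.
  apply/negPn/negP => lS.
  by have := (hM I).1 _ _ lM jM; rewrite leqNgt topS.
have := subset_leq_card sub; rewrite (eqP (card_chosen _)).
by move: cardS; rewrite (cardsD1 j S) jS; lia.
Qed.

Lemma middle_chosen_eq n m k (I : instance R n m k) (S : {set 'I_m}) :
  #|S| = k ->
  (forall j l, j \in S -> l \notin S ->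
     (approval_count I l < approval_count I j)%N) ->
  chosen (M I) = S.
Proof.
move=> cardS topS; apply/esym/eqP.
rewrite eqEcard middle_top_chosen ?cardS //.
by rewrite (eqP (card_chosen _)) leqnn.
Qed.

Section CentralAgent.

Variables (n m k : nat) (I I' : instance R n m k) (i : 'I_n).
Hypothesis posi : pos I i = 1 / 2.

(** The distance to [1 / 2] vanishes, so only the true approvals in [I] count, whichever report [I']
    produced the outcome. *)
Lemma central_facility_utility j : j \in chosen (M I') ->
  facility_utility I (M I') i j = (approves I i j)%:R.
Proof.
by move=> jM; rewrite /facility_utility posi (hM I').2 // subrr normr0 subr0 mulr1.
Qed.

Lemma central_utility_eq0 (C : utility_class) :
  C <> MaxClass -> (forall j, j \in chosen (M I') -> ~~ approves I i j) ->
  utility C I (M I') i = 0.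
Proof.
move=> hC un.
have fu0 j : j \in chosen (M I') -> facility_utility I (M I') i j = 0.
  by move=> jM; rewrite central_facility_utility // (negPf (un _ jM)).
case: C hC => // _ /=; first exact: big1.
by elim/big_ind: _ => // x y -> ->; rewrite maxxx.
Qed.

Lemma central_utility_gt0 (C : utility_class) j :
  C <> MaxClass -> j \in chosen (M I') -> approves I i j ->
  0 < utility C I (M I') i.
Proof.
move=> hC jM aj; have fj := central_facility_utility jM; rewrite aj in fj.
case: C hC => // _ /=; apply: (@lt_le_trans _ _ 1) => //.
  rewrite (bigD1 j) //= fj lerDl; apply: sumr_ge0 => l /andP[lM _].
  by rewrite central_facility_utility // ler0n.
by rewrite -[X in X <= _]fj; apply: le_bigmax_cond.
Qed.

Lemma central_max_utility_le0 j :
  j \in chosen (M I') -> ~~ approves I i j ->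
  utility MaxClass I (M I') i <= 0.
Proof.
move=> jM /negPf aj; have := central_facility_utility jM; rewrite aj => fj.
by rewrite -[X in _ <= X]fj /=; apply: bigmin_le_cond.
Qed.

Lemma central_max_utility_eq1 :
  (forall j, j \in chosen (M I') -> approves I i j) ->
  utility MaxClass I (M I') i = 1.
Proof.
(* The default 1 of the iterated min agrees with the value of every term. *)
move=> ap /=; elim/big_ind: _ => // [x y -> ->|j jM]; first by rewrite minxx.
by rewrite central_facility_utility // ap.
Qed.

End CentralAgent.

End Middle.

Section CentralInstance.

Variables (R : realType) (n m k : nat).
Hypotheses (n_gt0 : (0 < n)%N) (hk : (0 < k < m)%N).

Lemma central_pos_range :
  [forall i, 0 <= [ffun _ : 'I_n => 1 / 2 : R] i <= 1].
Proof. by apply/forallP => i; rewrite ffunE; lra. Qed.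

Definition central_instance (P : nat -> nat -> bool) : instance R n m k :=
  Instance [ffun i : 'I_n => [ffun j : 'I_m => P i j]] n_gt0 hk
    central_pos_range.

Lemma pos_central P i : pos (central_instance P) i = 1 / 2.
Proof. by rewrite ffunE. Qed.

Lemma approves_central P i j : approves (central_instance P) i j = P i j.
Proof. by rewrite !ffunE. Qed.

Lemma approval_count_central P j :
  approval_count (central_instance P) j = (\sum_(i < n) P i j)%N.
Proof.
rewrite /approval_count -sum1_card big_mkcond /=.
by apply: eq_bigr => i _; rewrite inE approves_central; case: (P i j).
Qed.

End CentralInstance.

Lemma card_ord_lt m k : (k <= m)%N -> #|[set j : 'I_m | (j < k)%N]| = k.
Proof.
move=> km; rewrite -sum1dep_card -(big_ord_widen m (fun=> 1%N)) //.
by rewrite sum1_card card_ord.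
Qed.

Definition typeA (i : nat) := (i < 2)%N.
Definition typeB (i : nat) := (2 <= i < 4)%N.
Definition coalition (i : nat) := (i < 4)%N.

Section Profiles.

Variable k : nat.

Definition summin_truth (i j : nat) : bool :=
  [|| typeA i && (j == k), typeB i && (j == k.+1)
    | ~~ coalition i && (j < k)%N].

Definition summin_report (i j : nat) : bool :=
  if coalition i then (k <= j < k.+2)%N else summin_truth i j.

Definition max_truth (i j : nat) : bool :=
  [|| coalition i && (j < k)%N, ~~ typeB i && (j == k)
    | ~~ typeA i && (j == k.+1)].

Definition max_report (i j : nat) : bool :=
  if coalition i then (j < k)%N else max_truth i j.

End Profiles.

Section Manipulation.

Variables (R : realType) (M : mechanism R) (k m : nat).
Hypotheses (hM : is_middle M) (k_ge2 : (2 <= k)%N) (m_gek2 : (k.+2 <= m)%N).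

Let hkm : (0 < k < m)%N. Proof. lia. Qed.

Local Notation inst := (@central_instance R 7 m k isT hkm).

Let F := [set j : 'I_m | (j < k)%N].
Let ab := [set j : 'I_m | (k <= j < k.+2)%N].

Let a := Ordinal (ltnW m_gek2).
Let b := Ordinal m_gek2.

Let cardF : #|F| = k.
Proof. by apply: card_ord_lt; lia. Qed.

(** This is where [k >= 2] enters: both [a] and [b] fit among the chosen facilities. *)
Let card_ab : (#|ab| <= k)%N.
Proof.
suff /subset_leq_card : ab \subset [set a; b].
  by move=> h; apply: leq_trans h _; rewrite cards2; lia.
by apply/subsetP => j; rewrite !inE -!val_eqE /=; lia.
Qed.

Let a_ab : a \in ab. Proof. by rewrite inE /=; lia. Qed.
Let b_ab : b \in ab. Proof. by rewrite inE /=; lia. Qed.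

(** Each count unfolds to seven Boolean terms, one per agent, and comparing two counts becomes
    linear arithmetic in [j], [l] and [k]. *)
Ltac count_votes :=
  move=> j l; rewrite !inE !approval_count_central !big_ord_recl !big_ord0
    /summin_report /max_report /summin_truth /max_truth /typeA /typeB
    /coalition /=; lia.

Let summin_truth_chosen : chosen (M (inst (summin_truth k))) = F.
Proof. by apply: middle_chosen_eq => //; count_votes. Qed.

(** Only an inclusion: the other [k - 2] choices are made among the tied facilities of [F]. *)
Let summin_report_chosen : ab \subset chosen (M (inst (summin_report k))).
Proof. by apply: middle_top_chosen => //; count_votes. Qed.

Let max_truth_chosen : ab \subset chosen (M (inst (max_truth k))).
Proof. by apply: middle_top_chosen => //; count_votes. Qed.

Let max_report_chosen : chosen (M (inst (max_report k))) = F.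
Proof. by apply: middle_chosen_eq => //; count_votes. Qed.

Let coalition_profitable C (P P' : nat -> nat -> bool) :
  (forall i j, ~~ coalition i -> P' i j = P i j) ->
  (forall i : 'I_7, coalition i ->
     utility C (inst P) (M (inst P)) i < utility C (inst P) (M (inst P')) i) ->
  ~ group_strategyproof C M k m.
Proof.
move=> PP' gain gsp.
apply: (gsp 7%N (inst P) (inst P') [set i : 'I_7 | coalition i]); split.
- by apply/set0Pn; exists ord0; rewrite inE.
- move=> i; rewrite inE => ni; split; first by rewrite !pos_central.
  by apply/ffunP => j; rewrite !approves_central PP'.
- by move=> i; rewrite inE; apply: gain.
Qed.

Lemma middle_not_gsp C : ~ group_strategyproof C M k m.
Proof.
have posi P i : pos (inst P) i = 1 / 2 by exact: pos_central.
have [->|CM] : C = MaxClass \/ C <> MaxClass by case: C; [right|right|left].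
- apply: (@coalition_profitable _ (max_truth k) (max_report k)).
    by move=> i j /negPf ni; rewrite /max_report ni.
  move=> i iG.
  rewrite [ltRHS](central_max_utility_eq1 hM) ?pos_central //; last first.
    by move=> j; rewrite max_report_chosen inE approves_central /max_truth iG => ->.
  apply: le_lt_trans (ltr01).
  (* Truthfully, type A is hurt by the chosen [b] and type B by the chosen [a]. *)
  have [iA|iA] := boolP (typeA i).
  + apply: (central_max_utility_le0 hM (posi _ _)
              (subsetP max_truth_chosen b b_ab)).
    by rewrite approves_central /max_truth iA /=; lia.
  + apply: (central_max_utility_le0 hM (posi _ _)
              (subsetP max_truth_chosen a a_ab)).
    rewrite approves_central /max_truth /=.
    by move: iA iG; rewrite /typeA /typeB /coalition; lia.
- apply: (@coalition_profitable _ (summin_truth k) (summin_report k)).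
    by move=> i j /negPf ni; rewrite /summin_report ni.
  move=> i iG.
  rewrite (central_utility_eq0 hM) ?pos_central //; last first.
    move=> j; rewrite summin_truth_chosen inE approves_central /summin_truth iG.
    by lia.
  (* After the misreport, type A gains from [a] and type B from [b]. *)
  have [iA|iA] := boolP (typeA i).
  + apply: (central_utility_gt0 hM (posi _ _) CM
              (subsetP summin_report_chosen a a_ab)).
    by rewrite approves_central /summin_truth iA eqxx.
  + apply: (central_utility_gt0 hM (posi _ _) CM
              (subsetP summin_report_chosen b b_ab)).
    rewrite approves_central /summin_truth /=.
    by move: iA iG; rewrite /typeA /typeB /coalition; lia.
Qed.

End Manipulation.

(** The manipulation uses two facilities beyond the [k] in [F], hence the bound [k.+2 <= m]; the
    case [m = k.+2] already refutes the claim for all [m]. *)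
Theorem lemma6p2 (R : realType) (C : utility_class) (M : mechanism R) (k : nat)
    (hM : is_middle M) (hk : (2 <= k)%N) :
  ~ (forall m : nat, (k < m)%N -> group_strategyproof C M k m) /\
  (forall m : nat, (k.+2 <= m)%N -> ~ group_strategyproof C M k m).
Proof.
split=> [gsp|m hm]; last exact: (middle_not_gsp hM hk hm).
by apply: (middle_not_gsp hM hk (leqnn k.+2) (C := C)); apply: gsp.
Qed.
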